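(* Let $p$ be a prime number and let $\phi\colon \mathbb{P}_1\to\mathbb{P}_1$ be an endomorphism of degree $d\geq 2$ defined over $\mathbb{F}_p(t)$ with good reduction at every finite place of $\mathbb{F}_p(t)$. If $P\in\mathbb{P}_1(\mathbb{F}_p(t))$ is a periodic point for $\phi$ with minimal period $n$, then \begin{itemize} \item $n\leq 3$ if $p=2$; \item $n\leq 72$ if $p=3$; \item $n\leq (p^2-1)p$ if $p\geq 5$. \end{itemize} More generally, if $P\in\mathbb{P}_1(\mathbb{F}_p(t))$ is a preperiodic point for $\phi$, then \begin{itemize} \item $|O_\phi(P)|\leq 9$ if $p=2$; \item $|O_\phi(P)|\leq 288$ if $p=3$; \item $|O_\phi(P)|\leq (p+1)(p^2-1)p$ if $p\geq 5$. \end{itemize}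
   Context: $\mathbb{F}_p$ is the field with $p$ elements and $\mathbb{F}_p(t)$ is the rational function field over it. $\mathbb{P}_1$ denotes the projective line. A point $P$ is periodic for $\phi$ if $\phi^n(P)=P$ for some integer $n>0$; the least such $n$ is its minimal period. The forward orbit of $P$ is $O_\phi(P)=\{\phi^n(P)\mid n\in\mathbb{N}\}$, where $0\in\mathbb{N}$ (so $P\in O_\phi(P)$). The point $P$ is preperiodic for $\phi$ if $O_\phi(P)$ contains a periodic point, equivalently if $O_\phi(P)$ is finite. Places: the finite places of $\mathbb{F}_p(t)$ are those associated to the monic irreducible polynomials $\pi\in\mathbb{F}_p[t]$, with corresponding $\pi$-adic valuation; the only other place is the place at infinity, with valuation $v_\infty(f/g)=\deg g-\deg f$. For a place $\mathfrak{p}$ with normalized valuation $v_{\mathfrak{p}}$, let $R_{\mathfrak{p}}=\{x\in \mathbb{F}_p(t)\mid v_{\mathfrak{p}}(x)\geq 0\}$ be the local ring at $\mathfrak{p}$ and $k(\mathfrak{p})$ its residue field. Good reduction: write $\phi([X:Y])=[F(X,Y):G(X,Y)]$ with $F,G$ coprime homogeneous polynomials of the same degree, scaled by an element of $\mathbb{F}_p(t)^*$ so that all coefficients of $F$ and $G$ lie in $R_{\mathfrak{p}}$ and at least one of them is a unit of $R_{\mathfrak{p}}$ ($\mathfrak{p}$-reduced form). The reduced map $\phi_{\mathfrak{p}}$ is the rational map of $\mathbb{P}_1$ over $k(\mathfrak{p})$ defined by reducing the coefficients of $F$ and $G$ modulo $\mathfrak{p}$. The map $\phi$ has good reduction at $\mathfrak{p}$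 if $\deg\phi=\deg\phi_{\mathfrak{p}}$; equivalently, the homogeneous resultant of $F$ and $G$ (in $\mathfrak{p}$-reduced form) is a unit of $R_{\mathfrak{p}}$. *)

(* Defs.v *)
From HB Require Import structures.
From mathcomp Require Import all_boot all_order all_algebra.
From mathcomp Require Import generic_quotient ring_quotient fraction.
From mathcomp Require Import finmap mpoly ring zify.

Set Implicit Arguments.
Unset Strict Implicit.
Unset Printing Implicit Defensive.

Import Order.TTheory GRing.Theory Num.Theory.

Local Open Scope ring_scope.
Local Open Scope quotient_scope.

Section ProjectiveLine.
Variable K : fieldType.

Definition hcoord := {u : 'rV[K]_2 | u != 0}.

Definition proj_eq (u v : hcoord) : bool :=
  val u ord0 ord0 * val v ord0 ord_max == val u ord0 ord_max * val v ord0 ord0.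

Lemma hcoordP (u : hcoord) : exists i, val u ord0 i != 0.
Proof.
case: u => u u0 /=; apply/existsP; apply: contraR u0.
rewrite negb_exists => /forallP u0; apply/eqP; apply/rowP => i.
by rewrite mxE; apply/eqP; have := u0 i; rewrite negbK.
Qed.

Lemma ord2P (i : 'I_2) : i = ord0 \/ i = ord_max.
Proof. by case: i => [[|[|//]] hi]; [left|right]; apply/val_inj. Qed.

Lemma proj_eqP (u v : hcoord) :
  reflect (exists2 c, c != 0 & val v = c *: val u) (proj_eq u v).
Proof.
apply: (iffP eqP) => [uv|[c _ ->]]; last by rewrite !mxE mulrCA [RHS]mulrCA [X in c * X]mulrC.
have vE c : val v = c *: val u -> c != 0.
  by move=> e; apply: contra_neq (valP v) => c0; rewrite e c0 scale0r.
have [i] := hcoordP u; case: (ord2P i) => -> ui.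
  have e : val v = (val v ord0 ord0 / val u ord0 ord0) *: val u.
    apply/rowP => j; rewrite !mxE; case: (ord2P j) => ->; first by rewrite divfK.
    by apply: (mulfI ui); rewrite uv mulrA [_ * (_ / _)]mulrC divfK// mulrC.
  by eexists; [apply: vE e | exact: e].
have e : val v = (val v ord0 ord_max / val u ord0 ord_max) *: val u.
  apply/rowP => j; rewrite !mxE; case: (ord2P j) => ->; last by rewrite divfK.
  by apply: (mulfI ui); rewrite -uv mulrA [_ * (_ / _)]mulrC divfK// mulrC.
by eexists; [apply: vE e | exact: e].
Qed.

Lemma proj_eq_refl : reflexive proj_eq.
Proof. by move=> u; apply/proj_eqP; exists 1; rewrite ?oner_eq0 ?scale1r. Qed.

Lemma proj_eq_sym : ssrbool.symmetric proj_eq.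
Proof.
suff s u v : proj_eq u v -> proj_eq v u by move=> u v; apply/idP/idP; apply: s.
case/proj_eqP => c c0 e; apply/proj_eqP; exists c^-1; first by rewrite invr_eq0.
by rewrite e scalerA mulVf// scale1r.
Qed.

Lemma proj_eq_trans : transitive proj_eq.
Proof.
move=> v u w /proj_eqP[c c0 e] /proj_eqP[b b0 e']; apply/proj_eqP.
by exists (b * c); rewrite ?mulf_neq0// e' e scalerA.
Qed.

Canonical proj_eq_equiv := EquivRel proj_eq proj_eq_refl proj_eq_sym proj_eq_trans.

Definition P1 := {eq_quot proj_eq}.
HB.instance Definition _ : EqQuotient _ proj_eq P1 := EqQuotient.on P1.
HB.instance Definition _ := Choice.on P1.

Definition mcoprime (F G : {mpoly K[2]}) : Prop :=
  forall H A B : {mpoly K[2]},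
    F = A * H -> G = B * H -> H \is a GRing.unit.

(* The morphism [X : Y] |-> [num(X, Y) : den(X, Y)]; as num and den are coprime
   forms of degree deg, deg is its degree as a morphism. *)
Record endo := Endo {
  num : {mpoly K[2]};
  den : {mpoly K[2]};
  deg : nat;
  num_homog : num \is deg.-homog;
  den_homog : den \is deg.-homog;
  num_den_coprime : mcoprime num den
}.

Lemma homog_scale d (F : {mpoly K[2]}) (c : K) (u : 'I_2 -> K) :
  F \is d.-homog -> F.@[fun i => c * u i] = c ^+ d * F.@[u].
Proof.
move=> /dhomogP hF; rewrite !mevalE mulr_sumr big_seq [RHS]big_seq.
apply: eq_bigr => m /hF /= <-; rewrite mulrCA; congr (_ * _).
rewrite mdegE -prodrXr -big_split /=; apply: eq_bigr => i _.
by rewrite exprMn.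
Qed.

Lemma homog_root_dvd d (F : {mpoly K[2]}) (u : hcoord) :
  F \is d.-homog -> F.@[val u ord0] = 0 ->
  exists A, F = A * ((val u ord0 ord_max) *: 'X_ord0 - (val u ord0 ord0) *: 'X_ord_max).
Proof.
move=> hF F0; set L := _ - _.
pose cong (a b : {mpoly K[2]}) := exists C, a = b + C * L.
have congr a : cong a a by exists 0; rewrite mul0r addr0.
have congD a b a' b' : cong a b -> cong a' b' -> cong (a + a') (b + b').
  by move=> [C ->] [D ->]; exists (C + D); rewrite mulrDl addrACA.
have congM a b a' b' : cong a b -> cong a' b' -> cong (a * a') (b * b').
  move=> [C ->] [D ->]; exists (C * b' + b * D + C * D * L).
  ring.
have congX a b k : cong a b -> cong (a ^+ k) (b ^+ k).
  by move=> ab; elim: k => [|k IH]; rewrite ?expr0 ?exprS//; apply: congM.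
have [i ui] := hcoordP u.
have congV k : cong (val u ord0 i *: 'X_k) (val u ord0 k *: 'X_i).
  case: (ord2P i) => ->; case: (ord2P k) => ->; try exact: congr.
    by exists (- 1); rewrite mulN1r /L opprB addrCA subrr addr0.
  by exists 1; rewrite mul1r /L addrCA subrr addr0.
pose S (w : 'I_2 -> {mpoly K[2]}) :=
  \sum_(m <- msupp F) (F@_m)%:MP * \prod_k w k ^+ m k.
have S_X : S (fun k => val u ord0 i *: 'X_k) = (val u ord0 i ^+ d) *: F.
  rewrite [in RHS](mpolyE F) scaler_sumr /S big_seq [RHS]big_seq; apply: eq_bigr => m.
  move=> /(dhomogP _ _ _ hF) /= <-; rewrite mul_mpolyC scalerA mulrC -scalerA.
  congr (_ *: _); rewrite mpolyXE_id mdegE -prodrXr -scaler_prod.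
  by apply: eq_bigr => k _; rewrite exprZn.
have S_u : S (fun k => val u ord0 k *: 'X_i) = 0.
  transitivity (F.@[val u ord0] *: 'X_i ^+ d : {mpoly K[2]}); last first.
    by rewrite F0 scale0r.
  rewrite mevalE scaler_suml /S big_seq [RHS]big_seq; apply: eq_bigr => m.
  move=> /(dhomogP _ _ _ hF) /= <-; rewrite mul_mpolyC -scalerA; congr (_ *: _).
  rewrite mdegE -prodrXr -scaler_prod.
  by apply: eq_bigr => k _; rewrite exprZn.
have key : cong ((val u ord0 i ^+ d) *: F) 0.
  have congS w w' : (forall k, cong (w k) (w' k)) -> cong (S w) (S w').
    move=> ww'; rewrite /S; elim/big_rec2: _ => // m a b _; apply: congD.
    by apply: (congM) => //; elim/big_rec2: _ => // k a' b' _; apply/congM/congX.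
  by have := congS _ _ congV; rewrite S_X S_u.
case: key => C; rewrite add0r => e; exists ((val u ord0 i ^- d) *: C).
by rewrite -scalerAl -e scalerA mulVf ?scale1r// expf_neq0.
Qed.

Lemma endo_hcoord_subproof (phi : endo) (u : hcoord) :
  \row_(i < 2) (if i == ord0 then num phi else den phi).@[val u ord0] != 0.
Proof.
apply/eqP => /rowP e.
have := e ord0; rewrite !mxE /= => /(homog_root_dvd (num_homog phi))[A hA].
have := e ord_max; rewrite !mxE /= => /(homog_root_dvd (den_homog phi))[B hB].
have := num_den_coprime hA hB => /mulrV /(congr1 (meval (val u ord0))).
rewrite mevalM mevalB !mevalZ !mevalXU meval1 mulrC [_ * val u _ _]mulrC.
by rewrite subrr mulr0 => /eqP; rewrite eq_sym oner_eq0.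
Qed.

Definition endo_hcoord (phi : endo) (u : hcoord) : hcoord :=
  exist (fun v : 'rV[K]_2 => v != 0) _ (endo_hcoord_subproof phi u).

Definition endo_map (phi : endo) (P : P1) : P1 :=
  \pi_P1 (endo_hcoord phi (repr P)).

Lemma endo_map_pi (phi : endo) (u : hcoord) :
  endo_map phi (\pi_P1 u) = \pi_P1 (endo_hcoord phi u).
Proof.
apply/eqmodP/proj_eqP.
have /eqmodP/proj_eqP[c c0 e] : repr (\pi_P1 u) = u %[mod P1] by rewrite reprK.
exists (c ^+ deg phi); first exact: expf_neq0.
have h i : val u ord0 i = c * val (repr (\pi_P1 u)) ord0 i by rewrite e mxE.
apply/rowP => i; rewrite !mxE (meval_eq _ h).
by case: (ord2P i) => -> /=; rewrite (homog_scale _ _ (num_homog _), homog_scale _ _ (den_homog _)).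
Qed.

End ProjectiveLine.

Section FinitePlaces.
Variable F : fieldType.
Local Notation K := {fraction {poly F}}.
Local Notation "x %:F" := (FracField.tofrac x).

Record finite_place := FinitePlace {
  place_poly :> {poly F};
  place_irr : irreducible_poly place_poly;
  place_monic : place_poly \is monic
}.

Variable pi : finite_place.
Local Notation p := (place_poly pi).
Implicit Types (f g : {poly F}) (x y : K).

(* The largest k such that pi ^+ k divides f != 0; such a k is < size f. *)
Definition pmult f : nat := \max_(k < size f | p ^+ k %| f) k.

Lemma pmult_dvd f k : f != 0 -> (p ^+ k %| f) = (k <= pmult f)%N.
Proof.
move=> f0; have pi1 : (1 < size p)%N by have [] := place_irr pi.
have dvdW i j : (i <= j)%N -> p ^+ j %| f -> p ^+ i %| f.
  by move=> ij; apply: dvdp_trans; apply: dvdp_exp2l.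
apply/idP/idP => [kf|].
  have ks : (k < size f)%N.
    have := dvdp_leq f0 kf; apply: leq_trans.
    have -> : size (p ^+ k) = ((size p).-1 * k).+1.
      by rewrite -size_exp prednK// lt0n size_poly_eq0 expf_neq0// -size_poly_gt0 ltnW.
    by rewrite ltnS leq_pmull// -ltnS prednK// ltnW.
  exact: (@leq_bigmax_cond _ _ (fun i : 'I_(size f) => nat_of_ord i) (Ordinal ks)).
case: k => [|k]; first by rewrite expr0 dvd1p.
rewrite /pmult => /dvdW; apply.
have := @eq_bigmax_cond _ [pred k : 'I_(size f) | p ^+ k %| f]
  (fun i : 'I_(size f) => nat_of_ord i).
case=> [|i]; last by rewrite inE => hi ->.
have s0 : (0 < size f)%N by rewrite size_poly_gt0.
apply/card_gt0P; exists (Ordinal s0); by rewrite inE /= expr0 dvd1p.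
Qed.

Lemma pmultP f : f != 0 ->
  exists2 g, f = p ^+ pmult f * g & ~~ (p %| g).
Proof.
move=> f0; have /dvdpP[g e] : p ^+ pmult f %| f by rewrite pmult_dvd.
exists g; first by rewrite mulrC.
apply/negP => /dvdpP[h e']; have : p ^+ (pmult f).+1 %| f.
  by rewrite {2}e e' -mulrA -exprS dvdp_mull.
by rewrite pmult_dvd// ltnn.
Qed.

Lemma place_primeM f g : p %| f * g = (p %| f) || (p %| g).
Proof.
apply/idP/orP => [h|[] h]; [|exact: dvdp_mulr|exact: dvdp_mull].
have [pf|nf] := boolP (p %| f); [by left|right].
by rewrite -(@Gauss_dvdpr _ _ f)// irreducible_poly_coprime//; apply: place_irr.
Qed.

Lemma pmult_uniq f g k : ~~ (p %| g) -> f = p ^+ k * g -> pmult f = k.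
Proof.
move=> ng e; have g0 : g != 0 by apply: contraNneq ng => ->; rewrite dvdp0.
have pi0 : p != 0 by apply: irredp_neq0 (place_irr pi).
have f0 : f != 0 by rewrite e mulf_neq0// expf_neq0.
apply/eqP; rewrite eqn_leq -pmult_dvd// {2}e dvdp_mulr// andbT leqNgt.
by rewrite -pmult_dvd// e exprSr dvdp_mul2l// expf_neq0.
Qed.

Lemma pmultM f g : f != 0 -> g != 0 -> pmult (f * g) = (pmult f + pmult g)%N.
Proof.
move=> /pmultP[a fE na] /pmultP[b gE nb]; apply: (@pmult_uniq _ (a * b)).
  by rewrite place_primeM negb_or na.
by rewrite {1}fE {1}gE exprD mulrACA.
Qed.

(* The value at 0, where the valuation is infinite, is meaningless. *)
Definition valuation x : int :=
  (pmult \n_(repr x))%:Z - (pmult \d_(repr x))%:Z.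
Arguments valuation : simpl never.

Lemma repr_num_den x : x * (\d_(repr x))%:F = (\n_(repr x))%:F.
Proof.
rewrite -{1}[x]reprK; move: (repr x) => r; unlock FracField.tofrac.
rewrite -[LHS]FracField.pi_mul; apply/eqmodP; rewrite /= FracField.equivfE /FracField.mulf /=.
rewrite !numden_Ratio ?oner_neq0 ?mulf_neq0 ?oner_neq0 ?denom_ratioP//.
by rewrite !mulr1 mulrC.
Qed.

Lemma valuation_frac f g : f != 0 -> g != 0 ->
  valuation (f%:F / g%:F) = (pmult f)%:Z - (pmult g)%:Z.
Proof.
move=> f0 g0; set x := f%:F / g%:F; have d0 := denom_ratioP (repr x).
have e : f * \d_(repr x) = g * \n_(repr x).
  apply/eqP; rewrite -tofrac_eq !tofracM -repr_num_den /x.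
  by rewrite mulrA [_ * (_ / _)]mulrC divfK// tofrac_eq0.
have n0 : \n_(repr x) != 0.
  by apply: contra_neq (mulf_neq0 f0 d0) => n0; rewrite e n0 mulr0.
have /(congr1 pmult) := e; rewrite !pmultM// => {}e.
apply/eqP; rewrite /valuation subr_eq addrAC eq_sym subr_eq -!PoszD eqz_nat.
by rewrite e addnC.
Qed.

Lemma frac_repr x : x != 0 -> exists f g, [/\ f != 0, g != 0 & x = f%:F / g%:F].
Proof.
move=> x0; exists \n_(repr x), \d_(repr x); have d0 := denom_ratioP (repr x).
have dF0 : (\d_(repr x))%:F != 0 :> K by rewrite tofrac_eq0.
have xE : x = (\n_(repr x))%:F / (\d_(repr x))%:F.
  by rewrite -repr_num_den; exact: (esym (mulfK dF0 x)).
split; [|exact: d0|exact: xE].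
by rewrite -tofrac_eq0 -repr_num_den; exact: mulf_neq0 x0 dF0.
Qed.

Lemma valuationM x y : x != 0 -> y != 0 -> valuation (x * y) = valuation x + valuation y.
Proof.
move=> /frac_repr[a [b [a0 b0 ->]]] /frac_repr[c [d [c0 d0 ->]]].
rewrite mulf_div -!tofracM !valuation_frac ?mulf_neq0// !pmultM// !PoszD; ring.
Qed.

Lemma valuation1 : valuation 1 = 0.
Proof.
by apply: (@addrI _ (valuation 1)); rewrite -valuationM ?oner_neq0// mulr1 addr0.
Qed.

Lemma valuationV x : x != 0 -> valuation x^-1 = - valuation x.
Proof.
move=> x0; apply: (@addrI _ (valuation x)); rewrite -valuationM ?invr_eq0//.
by rewrite mulfV// valuation1 subrr.
Qed.

Lemma valuationN x : valuation (- x) = valuation x.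
Proof.
have [->|x0] := eqVneq x 0; first by rewrite oppr0.
have N1 : (-1 : K) != 0 by rewrite oppr_eq0 oner_neq0.
have : valuation (-1) + valuation (-1) = 0 by rewrite -valuationM// mulrNN mulr1 valuation1.
move: (valuation (-1)) (valuationM N1 x0) => k; rewrite mulN1r => -> k2.
by have -> : k = 0 by [lia]; rewrite add0r.
Qed.

Lemma valuationD x y : x != 0 -> y != 0 -> x + y != 0 ->
  Num.min (valuation x) (valuation y) <= valuation (x + y).
Proof.
move=> /frac_repr[a [b [a0 b0 ->]]] /frac_repr[c [d [c0 d0 ->]]].
rewrite addf_div ?tofrac_eq0// -!tofracM -tofracD.
have bd0 : b * d != 0 by rewrite mulf_neq0.
move=> s0; have n0 : a * d + c * b != 0.
  by apply: contra_neq s0 => ->; rewrite tofrac0 mul0r.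
rewrite !valuation_frac//.
have : (minn (pmult (a * d)) (pmult (c * b)) <= pmult (a * d + c * b))%N.
  by rewrite -pmult_dvd// dvdp_add// pmult_dvd ?mulf_neq0// ?geq_minl ?geq_minr.
rewrite !pmultM//.
move: (pmult a) (pmult b) (pmult c) (pmult d) (pmult (_ + _)) => i j k l m.
by rewrite geq_min ge_min; lia.
Qed.

Definition val_ring : {pred K} := fun x => (x == 0) || (0 <= valuation x).

Lemma val_ring_subring : subring_closed val_ring.
Proof.
split=> [|x y|x y]; rewrite !unfold_in /val_ring.
- by rewrite valuation1 lexx orbT.
- have [->|x0] := eqVneq x 0; first by rewrite sub0r oppr_eq0 valuationN.
  have [->|y0] := eqVneq y 0; first by rewrite subr0 (negPf x0).
  have [//|s0 /= vx vy] := eqVneq (x - y) 0.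
  have y0' : - y != 0 by rewrite oppr_eq0; exact: y0.
  have := valuationD x0 y0' s0; rewrite valuationN; apply: le_trans.
  by rewrite le_min vx vy.
- have [->|x0] := eqVneq x 0; first by rewrite mul0r eqxx.
  have [->|y0] := eqVneq y 0; first by rewrite mulr0 eqxx.
  rewrite /= mulf_eq0 (negPf x0) (negPf y0) /= (valuationM x0 y0).
  exact: addr_ge0.
Qed.

HB.instance Definition _ := GRing.isSubringClosed.Build K val_ring val_ring_subring.

Definition local_ring := {x : K | x \in val_ring}.
HB.instance Definition _ := SubChoice.on local_ring.
HB.instance Definition _ := [SubChoice_isSubComNzRing of local_ring by <:].

Definition local_unit : pred local_ring :=
  fun x : local_ring => (val x != 0) && (valuation (val x) == 0).

Lemma local_inv_subproof (x : local_ring) :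
  (if local_unit x then (val x)^-1 else val x) \in val_ring.
Proof.
case: ifP => [/andP[x0 /eqP vx]|_]; last exact: valP.
by rewrite unfold_in /val_ring valuationV// vx oppr0 lexx orbT.
Qed.

Definition local_inv (x : local_ring) : local_ring :=
  exist (fun y => y \in val_ring) _ (local_inv_subproof x).

Lemma local_mulVr : {in local_unit, left_inverse 1 local_inv *%R}.
Proof.
move=> x ux; apply: val_inj; rewrite rmorphM rmorph1 /=.
have {}ux : local_unit x := ux; rewrite ux.
by apply: mulVf; case/andP: ux.
Qed.

Lemma local_unitPl (x y : local_ring) : y * x = 1 -> local_unit x.
Proof.
move=> yx; have e : val y * val x = 1 := congr1 val yx.
have x0 : val x != 0 by apply/eqP => x0; move/eqP: e; rewrite x0 mulr0 eq_sym oner_eq0.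
have y0 : val y != 0 by apply/eqP => y0; move/eqP: e; rewrite y0 mul0r eq_sym oner_eq0.
have := valP x; have := valP y; rewrite !unfold_in /val_ring (negPf x0) (negPf y0) /=.
have := valuationM y0 x0; rewrite e valuation1 /local_unit x0 /=.
by move: (valuation _) (valuation _) => i j; lia.
Qed.

Lemma local_inv_out : {in [predC local_unit], local_inv =1 (@id local_ring)}.
Proof.
move=> x nx; apply: val_inj => /=.
by have {nx}/negPf-> : ~~ local_unit x := nx.
Qed.

HB.instance Definition _ := GRing.ComNzRing_hasMulInverse.Build local_ring
  local_mulVr local_unitPl local_inv_out.

Definition max_ideal : {pred local_ring} :=
  fun x : local_ring => (val x == 0) || (0 < valuation (val x)).

Lemma max_idealE (x : local_ring) : (x \in max_ideal) = (x \isn't a GRing.unit).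
Proof.
have -> : (x \isn't a GRing.unit) = ~~ local_unit x by [].
rewrite /local_unit negb_and negbK.
rewrite unfold_in /max_ideal; have [//|x0 /=] := eqVneq (val x) 0.
have := valP x; rewrite unfold_in /val_ring (negPf x0) /=.
by move: (valuation _) => i; lia.
Qed.

Lemma max_ideal_idealr : idealr_closed max_ideal.
Proof.
split=> [||a x y]; first by rewrite unfold_in /max_ideal rmorph0 eqxx.
  by rewrite max_idealE unitr1.
have mulI : x \in max_ideal -> a * x \in max_ideal.
  by rewrite !max_idealE unitrM negb_and => ->; rewrite orbT.
move=> /mulI {mulI}; move: (a * x) => {a}x; rewrite !unfold_in /max_ideal.
have -> : val (x + y) = val x + val y by [].
have [->|x0] := eqVneq (val x) 0; first by rewrite add0r.
have [->|y0] := eqVneq (val y) 0; first by rewrite addr0 (negPf x0).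
have [//|s0 /= vx vy] := eqVneq (val x + val y) 0.
have := valuationD x0 y0 s0; apply: lt_le_trans.
by rewrite lt_min vx vy.
Qed.

HB.instance Definition _ := isIdealr.Build local_ring max_ideal max_ideal_idealr.

Definition residue_field := {ideal_quot max_ideal}.
HB.instance Definition _ := GRing.ComNzRing.on residue_field.

Definition residue : local_ring -> residue_field := \pi_{ideal_quot max_ideal}.
HB.instance Definition _ := GRing.RMorphism.copy residue \pi_{ideal_quot max_ideal}.

Definition residue_inv (x : residue_field) : residue_field :=
  if x == 0 then 0 else residue (repr x)^-1.

Lemma residue_mulVf (x : residue_field) : x != 0 -> residue_inv x * x = 1.
Proof.
move=> x0; rewrite /residue_inv (negPf x0).
have xE : residue (repr x) = x := reprK x.
rewrite -{2}xE -rmorphM mulVr ?rmorph1//.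
rewrite -[_ \is a _]negbK -max_idealE -[X in X \in _]subr0 Quotient.idealrBE.
by apply: contraNN x0 => /eqP e; rewrite -xE; apply/eqP/(etrans e)/(rmorph0 residue).
Qed.

Lemma residue_inv0 : residue_inv 0 = 0.
Proof. by rewrite /residue_inv eqxx. Qed.

HB.instance Definition _ :=
  GRing.ComNzRing_isField.Build residue_field residue_mulVf residue_inv0.

End FinitePlaces.

Section GoodReduction.
Variable F : fieldType.
Local Notation K := {fraction {poly F}}.
Variables (pi : finite_place F) (phi : endo K).

Definition reduced_form (A B : {mpoly (local_ring pi)[2]}) : Prop :=
  (exists c : K, [/\ c != 0, c *: num phi = map_mpoly val A
                           & c *: den phi = map_mpoly val B]) /\
  (exists m, (A@_m \is a GRing.unit) || (B@_m \is a GRing.unit)).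

(* Reducing a reduced form may create common factors: the reduced map is the
   morphism psi equal to [A mod pi : B mod pi] as a rational map, and its degree
   is that of psi. *)
Definition reduced_map (psi : endo (residue_field pi)) : Prop :=
  exists A B, reduced_form A B /\
    map_mpoly (@residue F pi) A * den psi = map_mpoly (@residue F pi) B * num psi.

Definition good_reduction : Prop :=
  exists2 psi : endo (residue_field pi), reduced_map psi & deg phi = deg psi.

End GoodReduction.

Section Dynamics.
Variables (T : choiceType) (f : T -> T).

Definition periodic (x : T) : Prop := exists2 n, (0 < n)%N & iter n f x = x.

Definition minimal_period (x : T) (n : nat) : Prop :=
  [/\ (0 < n)%N, iter n f x = x
    & forall m, (0 < m < n)%N -> iter m f x <> x].

Definition forward_orbit (x y : T) : Prop := exists n, y = iter n f x.

Definition preperiodic (x : T) : Prop :=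
  exists2 y, forward_orbit x y & periodic y.

End Dynamics.

Definition card_le (T : choiceType) (A : T -> Prop) (N : nat) : Prop :=
  exists2 S : {fset T}, (forall x, A x <-> x \in S) & (#|` S| <= N)%N.

(* Main.v *)
Require Import Defs.
From mathcomp Require Import all_boot all_order all_algebra.
From mathcomp Require Import generic_quotient ring_quotient fraction.
From mathcomp Require Import finmap mpoly ring zify.
From Stdlib Require Import Classical.

(** Since the polynomials over a field k form a principal ideal domain, every
    point P of the projective line over k(t) has a pair of coprime polynomials
    as coordinates, unique up to a constant.  The determinant [chord P Q] of
    the coordinates of two points is a polynomial, defined up to a constant
    factor; its order at a place is the logarithmic distance of P and Q there,
    so the ultrametric inequality reads: a common divisor of [chord P Q] and
    [chord Q R] divides [chord P R] ([dvdp_chord_trans]).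

    A map with good reduction at every finite place satisfies
    [chord P Q %| chord (phi P) (phi Q)] ([good_reduction_nonexpanding]).
    At one place, the reduced form (A, B) of phi has no common zero modulo the
    place, so that (A(u), B(u)) is again a primitive coordinate vector; and
    modulo the determinant of u and v, these vectors are proportional, hence
    so are their images.

    The bounds then come from counting.  Over a finite field with q elements,
    at most q - 1 points R can have [chord P R] and [chord Q R] associated, for
    given P <> Q: the ratio of the two determinants is a nonzero constant, and
    it determines R ([card_equidistant]).

    On a cycle of exact length n through P, the chord between P and phi^i P
    depends only on gcd(i, n), and chords are invariant under translation along
    the cycle, both up to constants.  Let r be a prime divisor of n and m = n / r.  If r divides
    neither i nor i + m, then gcd(i, n) = gcd(i + m, n), so phi^(i+m) P is
    equidistant from P and phi^m P.  At least (r - 2) m indices i < n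
    qualify, and n / 2 of them if r = 2 and 4 divides n.  Choosing r odd, or
    r = 2 when 4 divides n, gives n <= max(2, 3 (q - 1)) ([period_bound]).

    For preperiodic P, the iterate psi = phi^n fixes some point Z in the orbit
    of P, where n is the length of the cycle.  Every point of the psi-orbit
    that comes before the last point Q <> Z is equidistant from Z and Q, so
    the tail of the psi-orbit has at most q points ([iter_card_fixed]), and
    the orbit of P under phi has at most (q + 1) n points ([card_orbit]).  With
    q = p these bounds imply the stated ones. *)

Set Implicit Arguments.
Unset Strict Implicit.
Unset Printing Implicit Defensive.

Import Order.TTheory GRing.Theory Num.Theory.

Local Open Scope ring_scope.
Local Open Scope quotient_scope.

Local Notation "x %:F" := (FracField.tofrac x).

(** * Determinants of pairs *)

Definition wedge (R : pzRingType) (u v : R * R) : R := u.1 * v.2 - u.2 * v.1.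

Lemma wedgeC (R : comPzRingType) (u v : R * R) : wedge u v = - wedge v u.
Proof. by rewrite /wedge opprB [v.1 * _]mulrC [v.2 * _]mulrC. Qed.

(** The Pluecker relation between three vectors of the plane, applied to the
    linear form with coefficients a, b. *)
Lemma wedge_pluecker (R : comPzRingType) (u v w : R * R) a b :
  wedge u w * (a * v.1 + b * v.2) =
  wedge u v * (a * w.1 + b * w.2) + wedge v w * (a * u.1 + b * u.2).
Proof. by case: u v w => [? ?] [? ?] [? ?]; rewrite /wedge /=; ring. Qed.

(** The ratio of the determinants against u and v determines a vector up to
    proportionality: both w and w' are orthogonal to u - k v, which is nonzero
    because u and v are independent. *)
Lemma wedge_ratio_inj (R : idomainType) (u v w w' : R * R) (k : R) :
  wedge u w = k * wedge v w -> wedge u w' = k * wedge v w' ->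
  wedge u v != 0 -> wedge w w' = 0.
Proof.
move: u v w w' => [p1 p2] [q1 q2] [r1 r2] [s1 s2]; rewrite /wedge /= => eR eS PQ.
pose t1 := p1 - k * q1; pose t2 := p2 - k * q2.
have /eqP wR : t1 * r2 - t2 * r1 == 0.
  by rewrite -[0](subrr (k * (q1 * r2 - q2 * r1))) -{1}eR; apply/eqP; rewrite /t1 /t2; ring.
have /eqP wS : t1 * s2 - t2 * s1 == 0.
  by rewrite -[0](subrr (k * (q1 * s2 - q2 * s1))) -{1}eS; apply/eqP; rewrite /t1 /t2; ring.
have m1 : t1 * (r1 * s2 - r2 * s1) = r1 * (t1 * s2 - t2 * s1) - s1 * (t1 * r2 - t2 * r1).
  by ring.
have m2 : t2 * (r1 * s2 - r2 * s1) = r2 * (t1 * s2 - t2 * s1) - s2 * (t1 * r2 - t2 * r1).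
  by ring.
move: m1 m2; rewrite wR wS !mulr0 subr0 => /eqP m1 /eqP m2.
apply/eqP; apply: contraNT PQ => rs; move: m1 m2.
rewrite !mulf_eq0 (negPf rs) !orbF !subr_eq0 => /eqP-> /eqP->.
by apply/eqP; ring.
Qed.

Lemma rmorph_wedge (R S : comNzRingType) (f : {rmorphism R -> S}) a b u v :
  f (a * b * wedge u v) =
  wedge (f a * f u.1, f a * f u.2) (f b * f v.1, f b * f v.2).
Proof. by rewrite /wedge /= rmorphM rmorphB !rmorphM; ring. Qed.

Lemma coprimep_Bezout (F : fieldType) (a b : {poly F}) :
  coprimep a b -> exists u v, u * a + v * b = 1.
Proof.
case/Bezout_coprimepP=> -[u v] /eqpP[[c1 c2] /= /andP[c10 c20]] e.
exists ((c1 / c2) *: u), ((c1 / c2) *: v).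
rewrite -!scalerAl -scalerDr mulrC -scalerA e scalerA mulVf ?scale1r//.
Qed.

(** The ultrametric inequality at all places at once; coprimality of v allows
    the Pluecker relation to be read as an expression of [wedge u w] itself. *)
Lemma dvdp_wedge_trans (F : fieldType) (g : {poly F}) (u v w : {poly F} * {poly F}) :
  coprimep v.1 v.2 -> g %| wedge u v -> g %| wedge v w -> g %| wedge u w.
Proof.
move=> /coprimep_Bezout[a [b ab]] guv gvw.
rewrite -[wedge u w]mulr1 -ab wedge_pluecker.
by apply: dvdp_add; apply: dvdp_mulr.
Qed.

(** * Chords between points of the projective line over k(t) *)

Lemma cross_div (L : fieldType) (a b c d : L) :
  b != 0 -> d != 0 -> a / b * (c * b) = c / d * (a * d).
Proof. by move=> b0 d0; field; rewrite b0 d0. Qed.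

Section Chord.
Variable F : fieldType.
Local Notation K := {fraction {poly F}}.
Implicit Types (P Q R : P1 K) (u : {poly F} * {poly F}).

Definition coords_of P u : bool :=
  coprimep u.1 u.2 &&
  (val (repr P) ord0 ord0 * u.2%:F == val (repr P) ord0 ord_max * u.1%:F).

(** Clear the denominators of arbitrary homogeneous coordinates and divide by
    the greatest common divisor. *)
Lemma coords_of_ex P : exists u, coords_of P u.
Proof.
pose w := val (repr P); have w0 : w != 0 := valP (repr P).
have [a [b [b0 aE]]] : exists a b, b != 0 /\ w ord0 ord0 = a%:F / b%:F.
  have [->|/frac_repr[a [b [_ b0 ->]]]] := eqVneq (w ord0 ord0) 0; last by exists a, b.
  by exists 0, 1; rewrite oner_eq0 tofrac0 mul0r.
have [c [d [d0 cE]]] : exists c d, d != 0 /\ w ord0 ord_max = c%:F / d%:F.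
  have [->|/frac_repr[c [d [_ d0 ->]]]] := eqVneq (w ord0 ord_max) 0; last by exists c, d.
  by exists 0, 1; rewrite oner_eq0 tofrac0 mul0r.
have nz : (a * d != 0) || (c * b != 0).
  rewrite -negb_and; apply: contraNN w0 => /andP[]; rewrite !mulf_eq0 (negPf b0) (negPf d0).
  rewrite !orbF => /eqP a0 /eqP c0; apply/eqP/rowP => i; rewrite mxE.
  by case: (ord2P i) => ->; rewrite ?aE ?cE ?a0 ?c0 tofrac0 mul0r.
pose g := gcdp (a * d) (c * b); have g0 : g != 0 by rewrite gcdp_eq0 negb_and.
exists (a * d %/ g, c * b %/ g); rewrite /coords_of coprimep_div_gcd//=.
rewrite -/w aE cE; apply/eqP.
have gF : g%:F != 0 by rewrite tofrac_eq0.
apply: (mulIf gF); rewrite -[LHS]mulrA -[RHS]mulrA -!tofracM.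
rewrite !divpK ?dvdp_gcdl ?dvdp_gcdr// !tofracM.
by apply: cross_div; rewrite tofrac_eq0.
Qed.

Fact coords_subproof P : {u | coords_of P u}.
Proof. by exists (xchoose (coords_of_ex P)); apply: xchooseP. Qed.

Definition coords P := sval (coords_subproof P).

Lemma coords_coprime P : coprimep (coords P).1 (coords P).2.
Proof. by have /andP[] := svalP (coords_subproof P). Qed.

Lemma coords_Bezout P : exists a b, a * (coords P).1 + b * (coords P).2 = 1.
Proof. exact: coprimep_Bezout (coords_coprime P). Qed.

Lemma coords_scale P : exists2 c : K, c != 0 &
  forall i, val (repr P) ord0 i = c * (if i == ord0 then (coords P).1 else (coords P).2)%:F.
Proof.
have /andP[_ /eqP] := svalP (coords_subproof P); rewrite -/(coords P).
have [a [b ab]] := coords_Bezout P.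
have abF : a%:F * (coords P).1%:F + b%:F * (coords P).2%:F = 1.
  by rewrite -!tofracM -tofracD ab tofrac1.
set w := val (repr P) => e.
pose c := w ord0 ord0 * a%:F + w ord0 ord_max * b%:F.
have wE i : w ord0 i = c * (if i == ord0 then (coords P).1 else (coords P).2)%:F.
  rewrite -[LHS]mulr1 -abF /c; case: (ord2P i) => -> /=.
    by rewrite mulrDr mulrDl; congr (_ + _); [ring|rewrite mulrCA e; ring].
  by rewrite mulrDr mulrDl; congr (_ + _); [rewrite mulrCA -e; ring|ring].
exists c => //; apply: contraNneq (valP (repr P)) => c0.
by apply/eqP/rowP => i; rewrite mxE wE c0 mul0r.
Qed.

Definition chord P Q : {poly F} := wedge (coords P) (coords Q).

Lemma chord_eq0 P Q : (chord P Q == 0) = (P == Q).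
Proof.
apply/eqP/eqP => [|->]; last by rewrite /chord /wedge mulrC subrr.
move=> /eqP; rewrite subr_eq0 => /eqP /(congr1 (@FracField.tofrac _)).
rewrite !tofracM => e; rewrite -[P]reprK -[Q]reprK; apply/eqmodP; apply/eqP.
have [c c0 cE] := coords_scale P; have [d d0 dE] := coords_scale Q.
by rewrite !cE !dE /= mulrACA e [RHS]mulrACA.
Qed.

Lemma chordC P Q : chord P Q = - chord Q P.
Proof. exact: wedgeC. Qed.

Lemma dvdp_chordC g P Q : (g %| chord P Q) = (g %| chord Q P).
Proof. by rewrite chordC dvdpNr. Qed.

Lemma eqp_chordC P Q R S : (chord P Q %= chord R S) = (chord Q P %= chord S R).
Proof.
rewrite (chordC P) (chordC R); move: (chord Q P) (chord S R) => f g.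
by rewrite /eqp !dvdpNl !dvdpNr.
Qed.

Lemma dvdp_chord_trans g P Q R :
  g %| chord P Q -> g %| chord Q R -> g %| chord P R.
Proof. exact: dvdp_wedge_trans (coords_coprime Q). Qed.

End Chord.

(** * Binary forms and univariate polynomials *)

Lemma size_factor_le1 (R : idomainType) (f g : {poly R}) n :
  size g = n.+1 -> (size (f * g)%R <= n.+1)%N -> (size f <= 1)%N.
Proof.
have [->|f0] := eqVneq f 0; first by rewrite size_poly0.
move=> sg; have g0 : g != 0 by rewrite -size_poly_gt0 sg.
by rewrite size_mul// sg addnS /= -add1n leq_add2r.
Qed.

(** If (a, b) is proportional to a unimodular pair (f, g), then it is an actual
    multiple of it. *)
Lemma Bezout_proportional (R : comPzRingType) (f g a b u v : R) :
  u * f + v * g = 1 -> a * g = b * f ->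
  a = (u * a + v * b) * f /\ b = (u * a + v * b) * g.
Proof.
move=> uv e; split; rewrite -[LHS]mulr1 -uv mulrDr mulrDl.
  by rewrite [a * (v * g)]mulrCA e; congr (_ + _); ring.
by rewrite [b * (u * f)]mulrCA -e; congr (_ + _); ring.
Qed.

Section Dehomogenization.
Variable k : fieldType.
Implicit Types (F G H : {mpoly k[2]}) (f g h : {poly k}) (d e : nat).

Definition dehomog F : {poly k} :=
  (map_mpoly polyC F).@[fun i : 'I_2 => if i == ord0 then 'X else 1].

Definition homogenize d f : {mpoly k[2]} :=
  \sum_(i < d.+1) f`_i *: ('X_ord0 ^+ i * 'X_ord_max ^+ (d - i)).

Lemma dehomogM F G : dehomog (F * G) = dehomog F * dehomog G.
Proof. by rewrite /dehomog rmorphM mevalM. Qed.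

Lemma dehomog1 : dehomog 1 = 1.
Proof. by rewrite /dehomog rmorph1 meval1. Qed.

Lemma dehomogX m : dehomog 'X_[m] = 'X^(m ord0).
Proof.
by rewrite /dehomog map_mpolyX mevalX !big_ord_recl big_ord0 /= expr1n !mulr1.
Qed.

Lemma dehomogXU (i : 'I_2) : dehomog 'X_i = if i == ord0 then 'X else 1.
Proof. by rewrite /dehomog map_mpolyX mevalXU. Qed.

Lemma dehomog_sum (I : Type) (r : seq I) (c : I -> k) (G : I -> {mpoly k[2]}) :
  dehomog (\sum_(i <- r) c i *: G i) = \sum_(i <- r) c i *: dehomog (G i).
Proof.
elim/big_rec2: _ => [|i x y _ <-]; first by rewrite /dehomog raddf0 meval0.
by rewrite /dehomog raddfD /= mevalD map_mpolyZ mevalZ mul_polyC.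
Qed.

Lemma dehomogE F : dehomog F = \sum_(m <- msupp F) F@_m *: 'X^(m ord0).
Proof.
by rewrite {1}[F]mpolyE dehomog_sum; apply: eq_bigr => m _; rewrite dehomogX.
Qed.

Lemma homogenizeZ d c f : homogenize d (c *: f) = c *: homogenize d f.
Proof.
by rewrite /homogenize scaler_sumr; apply: eq_bigr => i _; rewrite coefZ scalerA.
Qed.

Lemma homogenize_dhomog d f : homogenize d f \is d.-homog.
Proof.
rewrite /homogenize; apply: rpred_sum => i _; apply: rpredZ.
have X_homog (j : 'I_2) n : ('X_j ^+ n : {mpoly k[2]}) \is n.-homog.
  by rewrite -{2}[n]mul1n; apply: dhomogMn; rewrite dhomogX /= mdeg1.
have /subnKC dE : (i <= d)%N by rewrite -ltnS.
by have := dhomogM (X_homog ord0 i) (X_homog ord_max (d - i)%N); rewrite dE.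
Qed.

Lemma dehomogK d F : F \is d.-homog -> homogenize d (dehomog F) = F.
Proof.
move=> hF; rewrite [RHS]mpolyE /homogenize.
transitivity (\sum_(i < d.+1) \sum_(m <- msupp F)
    (F@_m * (i == m ord0 :> nat)%:R) *: ('X_ord0 ^+ i * 'X_ord_max ^+ (d - i)) : {mpoly k[2]}).
  apply: eq_bigr => i _; rewrite dehomogE coef_sum scaler_suml; apply: eq_bigr => m _.
  by rewrite coefZ coefXn.
rewrite exchange_big /= big_seq [RHS]big_seq; apply: eq_bigr => m /(dhomogP _ _ _ hF) /= dE.
have {}dE : (m ord0 + m ord_max)%N = d.
  rewrite -dE mdegE !big_ord_recl big_ord0 addn0; congr (_ + m _)%N; exact/val_inj.
have m_lt : (m ord0 < d.+1)%N by rewrite -dE ltnS leq_addr.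
rewrite (bigD1 (Ordinal m_lt)) //= eqxx mulr1 big1 ?addr0 => [|i]; last first.
  by rewrite -val_eqE /= => /negPf->; rewrite mulr0 scale0r.
congr (_ *: _); rewrite [RHS]mpolyXE_id !big_ord_recl big_ord0 mulr1 -dE addKn.
by have -> : lift ord0 ord0 = ord_max :> 'I_2 by apply/val_inj.
Qed.

Lemma homogenizeK d f : (size f <= d.+1)%N -> dehomog (homogenize d f) = f.
Proof.
move=> sf; rewrite dehomog_sum -[RHS]coefK poly_def.
rewrite [RHS](big_ord_widen _ (fun i => f`_i *: 'X^i) sf) [RHS]big_mkcond /=.
apply: eq_bigr => i _; case: ltnP => hi; last by rewrite nth_default// scale0r.
have X_ (j : 'I_2) n : dehomog ('X_j ^+ n) = (if j == ord0 then 'X else 1) ^+ n.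
  by elim: n => [|n IH]; rewrite ?expr0 ?dehomog1// !exprS dehomogM IH dehomogXU.
by rewrite dehomogM !X_ /= expr1n mulr1.
Qed.

Lemma dehomog_inj d F G :
  F \is d.-homog -> G \is d.-homog -> dehomog F = dehomog G -> F = G.
Proof. by move=> hF hG e; rewrite -(dehomogK hF) e dehomogK. Qed.

Lemma size_dehomog d F : F \is d.-homog -> (size (dehomog F) <= d.+1)%N.
Proof.
move=> hF; rewrite dehomogE big_seq; apply: (leq_trans (size_sum _ _ _)).
apply/bigmax_leqP_seq => m _ mF; apply: (leq_trans (size_scale_leq _ _)).
rewrite size_polyXn ltnS -(dhomogP _ _ _ hF m mF) /= mdegE.
by rewrite !big_ord_recl leq_addr.
Qed.

(** Factors of the dehomogenized form lift to factors of the form; this brings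
    [mcoprime], a statement on bivariate polynomials, to gcds of univariate
    ones. *)
Lemma homogenize_dvd d e F f h : F \is d.-homog -> size h = e.+1 ->
  dehomog F = f * h -> exists G, F = G * homogenize e h.
Proof.
move=> hF sh fE; have [F0|F0] := eqVneq (dehomog F) 0.
  by exists 0; rewrite mul0r -(dehomogK hF) F0 /homogenize big1// => i _; rewrite coef0 scale0r.
have [f0 h0] : f != 0 /\ h != 0 by apply/andP; rewrite -negb_or -mulf_eq0 -fE.
have := size_dehomog hF; rewrite fE size_mul// sh addnS /= => sf.
have ed : (e <= d)%N.
  by rewrite -ltnS; apply: leq_trans sf; rewrite -[e.+1]add1n leq_add2r size_poly_gt0.
exists (homogenize (d - e) f); apply: (dehomog_inj hF).
  by have := dhomogM (homogenize_dhomog (d - e) f) (homogenize_dhomog e h); rewrite subnK.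
rewrite dehomogM !homogenizeK ?sh//.
by rewrite -(leq_add2r e) addSn subnK.
Qed.

Lemma unit_homogenize e h : size h = e.+1 ->
  homogenize e h \is a GRing.unit -> e = 0%N.
Proof.
move=> sh /mulrV /(congr1 dehomog); rewrite dehomogM dehomog1 homogenizeK ?sh//.
move=> hV; have := size_poly1 k; rewrite -hV.
have [h0 v0] : h != 0 /\ dehomog (homogenize e h)^-1 != 0.
  by apply/andP; rewrite -negb_or -mulf_eq0 hV oner_eq0.
by rewrite size_mul// sh; move: v0; rewrite -size_poly_gt0; move: (size _) => s; lia.
Qed.

Variable psi : endo k.
Local Notation f := (dehomog (num psi)).
Local Notation g := (dehomog (den psi)).
Local Notation d := (deg psi).

Lemma endo_neq0 : (f != 0) || (g != 0).
Proof.
rewrite -negb_and; apply/negP => /andP[/eqP f0 /eqP g0].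
have n0 : num psi = 0.
  by apply: dehomog_inj (num_homog psi) (rpred0 _) _; rewrite f0 /dehomog raddf0 meval0.
have d0 : den psi = 0.
  by apply: dehomog_inj (den_homog psi) (rpred0 _) _; rewrite g0 /dehomog raddf0 meval0.
have : (0 : {mpoly k[2]}) \is a GRing.unit.
  by apply: (@num_den_coprime _ psi 0 0 0); rewrite mulr0.
by rewrite unitr0.
Qed.

Lemma dehomog_coprime : coprimep f g.
Proof.
pose h := gcdp f g; have h0 : h != 0 by rewrite gcdp_eq0 negb_and endo_neq0.
have sh : size h = (size h).-1.+1 by rewrite prednK// size_poly_gt0.
have [A AE] := homogenize_dvd (num_homog psi) sh (esym (divpK (dvdp_gcdl f g))).
have [B BE] := homogenize_dvd (den_homog psi) sh (esym (divpK (dvdp_gcdr f g))).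
have := unit_homogenize sh (num_den_coprime AE BE).
by rewrite coprimep_def -/h sh /= => ->.
Qed.

(** The point at infinity is not a common zero: otherwise the second variable
    would divide both forms. *)
Lemma dehomog_size : (size f == d.+1) || (size g == d.+1).
Proof.
apply/orP; have := size_dehomog (num_homog psi); rewrite leq_eqVlt => /orP[sf|sf].
  by left; exact: sf.
have := size_dehomog (den_homog psi); rewrite leq_eqVlt => /orP[sg|sg].
  by right; exact: sg.
exfalso.
have : ('X_ord_max : {mpoly k[2]}) \is a GRing.unit.
  have dvdX F : F \is d.-homog -> (size (dehomog F) <= d)%N ->
      F = homogenize d.-1 (dehomog F) * 'X_ord_max.
    move=> hF sF; have [F0|F0] := eqVneq (dehomog F) 0.
      rewrite -[LHS](dehomogK hF) F0 /homogenize !big1 ?mul0r// => i _;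
        by rewrite coef0 scale0r.
    have d_gt0 : (0 < d)%N by apply: leq_trans sF; rewrite size_poly_gt0.
    apply: (dehomog_inj hF); last by rewrite dehomogM homogenizeK ?prednK// dehomogXU mulr1.
    have X_homog : ('X_ord_max : {mpoly k[2]}) \is 1.-homog by rewrite dhomogX /= mdeg1.
    by have := dhomogM (homogenize_dhomog d.-1 (dehomog F)) X_homog; rewrite addn1 prednK.
  exact: num_den_coprime (dvdX _ (num_homog psi) sf) (dvdX _ (den_homog psi) sg).
move=> /mulrV /(congr1 (meval (fun=> 0))).
by rewrite mevalM mevalXU mul0r meval1 => /eqP; rewrite eq_sym oner_eq0.
Qed.

(** The degree condition of good reduction enters here: as A and B have the
    degree of psi itself, no common factor is left, so that they represent
    psi up to a constant. By [dehomog_coprime] the proportionality factor is a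
    polynomial, and by [dehomog_size] it has degree 0. *)
Lemma proportional_forms (A B : {mpoly k[2]}) :
  A \is d.-homog -> B \is d.-homog -> (A != 0) || (B != 0) ->
  A * den psi = B * num psi ->
  exists c, [/\ c != 0, A = c *: num psi & B = c *: den psi].
Proof.
move=> hA hB AB0 /(congr1 dehomog); rewrite !dehomogM.
set a := dehomog A; set b := dehomog B => e.
have [u [v uv]] := coprimep_Bezout dehomog_coprime.
have [] := Bezout_proportional uv e; set C := u * a + v * b => aE bE.
have C0 : C != 0.
  apply: contraTneq AB0 => C0; rewrite -negb_and negbK.
  have zE F : F \is d.-homog -> dehomog F = 0 -> F == 0.
    by move=> hF F0; apply/eqP/(dehomog_inj hF (rpred0 _)); rewrite F0 /dehomog raddf0 meval0.
  have a0 : a = 0 by rewrite aE C0 mul0r.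
  have b0 : b = 0 by rewrite bE C0 mul0r.
  by rewrite (zE A hA a0) (zE B hB b0).
have sC : (size C <= 1)%N.
  have := size_dehomog hA; have := size_dehomog hB; rewrite -/a -/b aE bE.
  by case/orP: dehomog_size => /eqP sw; [move=> _|move=> + _]; apply: size_factor_le1.
move: C0 aE bE; rewrite (size1_polyC sC) polyC_eq0 => c0 aE bE.
exists C`_0; split; first exact: c0.
  by have := dehomogK hA; rewrite -/a aE mul_polyC homogenizeZ (dehomogK (num_homog psi)).
by have := dehomogK hB; rewrite -/b bE mul_polyC homogenizeZ (dehomogK (den_homog psi)).
Qed.

Lemma proportional_forms_eval (A B : {mpoly k[2]}) (u : 'I_2 -> k) :
  A \is d.-homog -> B \is d.-homog -> (A != 0) || (B != 0) ->
  A * den psi = B * num psi ->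
  (u ord0 != 0) || (u ord_max != 0) -> (A.@[u] != 0) || (B.@[u] != 0).
Proof.
move=> hA hB AB0 e u0; have [c [c0 -> ->]] := proportional_forms hA hB AB0 e.
pose w := \row_i u i; have w0 : w != 0.
  apply: contraTneq u0 => /rowP w0.
  by rewrite -negb_and negbK; move: (w0 ord0) (w0 ord_max); rewrite !mxE => -> ->; rewrite eqxx.
have := endo_hcoord_subproof psi (exist _ w w0).
have wE F : F.@[w ord0] = F.@[u] by apply: meval_eq => i; rewrite mxE.
rewrite !mevalZ !mulf_eq0 (negPf c0) /= -negb_and; apply: contraNN => /andP[/eqP n0 /eqP d0].
by apply/eqP/rowP => i; rewrite !mxE /=; case: ifP => _; rewrite wE.
Qed.

End Dehomogenization.

(** * Evaluation of forms over a commutative ring *)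

Section Congruence.
Variable R : comNzRingType.

Lemma meval_cong n (A : {mpoly R[n]}) (u v : 'I_n -> R) D :
  (forall i, exists t, u i = v i + D * t) -> exists t, A.@[u] = A.@[v] + D * t.
Proof.
move=> uv; pose cong a b := exists t : R, a = b + D * t.
have congr a : cong a a by exists 0; rewrite mulr0 addr0.
have congD a b a' b' : cong a b -> cong a' b' -> cong (a + a') (b + b').
  by move=> [s ->] [t ->]; exists (s + t); ring.
have congM a b a' b' : cong a b -> cong a' b' -> cong (a * a') (b * b').
  by move=> [s ->] [t ->]; exists (s * b' + b * t + D * s * t); ring.
have congX a b k : cong a b -> cong (a ^+ k) (b ^+ k).
  by move=> ab; elim: k => [|k IH]; rewrite ?expr0 ?exprS//; apply: congM.
rewrite !mevalE; apply: (big_ind2 cong) => [|a b a' b'|m _]; [exact: congr|exact: congD|].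
apply: (congM); first exact: congr.
apply: (big_ind2 cong) => [|a b a' b'|i _]; [exact: congr|exact: congM|].
exact: congX (uv i).
Qed.

Lemma meval_homog n d (A : {mpoly R[n]}) c (u : 'I_n -> R) :
  A \is d.-homog -> A.@[fun i => c * u i] = c ^+ d * A.@[u].
Proof.
move=> /dhomogP hA; rewrite !mevalE mulr_sumr big_seq [RHS]big_seq.
apply: eq_bigr => m /hA /= <-; rewrite mulrCA; congr (_ * _).
by rewrite mdegE -prodrXr -big_split /=; apply: eq_bigr => i _; rewrite exprMn.
Qed.

(** Modulo the determinant of u and v, the vectors u_i v and v_i u agree, so
    that homogeneity makes (A(v), B(v)) and (A(u), B(u)) proportional. *)
Lemma wedge_forms d (A B : {mpoly R[2]}) (u v : 'I_2 -> R) (i : 'I_2) :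
  A \is d.-homog -> B \is d.-homog ->
  exists t, u i ^+ d * wedge (A.@[u], B.@[u]) (A.@[v], B.@[v]) =
            wedge (u ord0, u ord_max) (v ord0, v ord_max) * t.
Proof.
move=> hA hB; set D := wedge (u ord0, _) _.
have uv j : exists t, u i * v j = v i * u j + D * t.
  rewrite /D /wedge /=; case: (ord2P i) => ->; case: (ord2P j) => ->.
  - by exists 0; ring.
  - by exists 1; ring.
  - by exists (-1); ring.
  - by exists 0; ring.
have [r] := meval_cong A uv; have [s] := meval_cong B uv.
rewrite !(meval_homog _ _ hA) !(meval_homog _ _ hB) => eB eA; exists (A.@[u] * s - B.@[u] * r).
rewrite /wedge /= mulrBr mulrCA eB [u i ^+ d * (B.@[u] * _)]mulrCA eA; ring.
Qed.

Lemma meval_homog_eq n d (A : {mpoly R[n]}) c (u w : 'I_n -> R) :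
  A \is d.-homog -> (forall i, w i = c * u i) -> A.@[w] = c ^+ d * A.@[u].
Proof. by move=> hA wE; rewrite -(meval_homog _ _ hA); apply: meval_eq. Qed.

End Congruence.

Section MapForms.
Variables (R S : comNzRingType) (n d : nat) (f : {rmorphism R -> S}).
Implicit Types A : {mpoly R[n]}.

Lemma meval_map_mpoly A (u : 'I_n -> R) :
  (map_mpoly f A).@[fun i => f (u i)] = f A.@[u].
Proof.
elim/mpolyind: A => [|c m A _ _ IH]; first by rewrite raddf0 !meval0 rmorph0.
rewrite raddfD /= !mevalD IH rmorphD map_mpolyZ !mevalZ map_mpolyX !mevalX rmorphM.
by rewrite rmorph_prod; congr (_ * _ + _); apply: eq_bigr => i _; rewrite rmorphXn.
Qed.

Lemma map_mpoly_homog A : A \is d.-homog -> map_mpoly f A \is d.-homog.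
Proof.
move=> hA; apply/dhomogP => m; rewrite mcoeff_msupp mcoeff_map_mpoly => nz.
by apply/eqP; apply: contraNT nz => /(dhomog_nemf_coeff hA) ->; rewrite raddf0.
Qed.

Lemma map_mpoly_homog_inj A : injective f -> map_mpoly f A \is d.-homog -> A \is d.-homog.
Proof.
move=> f_inj hA; apply/dhomogP => m; rewrite mcoeff_msupp => nz.
apply/eqP; apply: contraNT nz => /(dhomog_nemf_coeff hA).
by rewrite mcoeff_map_mpoly -[X in _ = X](rmorph0 f) => /f_inj ->.
Qed.

End MapForms.

(** * Good reduction at one place *)

Section LocalRing.
Variables (F : fieldType) (pi : finite_place F).
Local Notation K := {fraction {poly F}}.
Local Notation R := (local_ring pi).
Implicit Types f g : {poly F}.

Lemma valuation_tofrac f : f != 0 -> valuation pi f%:F = (pmult pi f)%:Z.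
Proof.
move=> f0; have e1 : pmult pi 1 = 0%N.
  apply: (@pmult_uniq _ pi 1 1 0); last by rewrite expr0 mulr1.
  by rewrite dvdp1; have [+ _] := place_irr pi; rewrite neq_ltn => ->; rewrite orbT.
have := @valuation_frac _ pi f 1 f0 (oner_neq0 _).
by rewrite tofrac1 divr1 e1 subr0.
Qed.

Lemma tofrac_val_ring f : f%:F \in val_ring pi.
Proof.
rewrite unfold_in /val_ring; have [->|f0] := eqVneq f 0; first by rewrite tofrac0 eqxx.
by rewrite valuation_tofrac ?orbT.
Qed.

Definition local_of_poly f : R := exist _ (f%:F) (tofrac_val_ring f).

Lemma local_of_poly_unit f : ~~ (place_poly pi %| f) -> local_of_poly f \is a GRing.unit.
Proof.
move=> pf; have f0 : f != 0 by apply: contraNneq pf => ->; rewrite dvdp0.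
have -> : (local_of_poly f \is a GRing.unit) = local_unit (local_of_poly f) by [].
rewrite /local_unit /= tofrac_eq0 f0 valuation_tofrac//=.
by rewrite (@pmult_uniq _ pi f f 0)// expr0 mul1r.
Qed.

Lemma residue_neq0 (x : R) : (residue x != 0) = (x \is a GRing.unit).
Proof.
apply/idP/idP => [|/mulrV /(congr1 (@residue F pi))]; last first.
  rewrite rmorphM rmorph1 /= => e; apply/eqP => x0; move/eqP: e.
  by rewrite x0 mul0r eq_sym oner_eq0.
rewrite -[x \is a _]negbK -max_idealE -[X in X \in _]subr0 Quotient.idealrBE.
by apply: contraNN => /eqP e; apply/eqP/(etrans e)/(rmorph0 (@residue F pi)).
Qed.

End LocalRing.

Section GoodReductionLocal.
Variables (F : fieldType) (pi : finite_place F).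
Local Notation K := {fraction {poly F}}.
Local Notation R := (local_ring pi).
Variable phi : endo K.

(** A reduced form at a place of good reduction sends primitive vectors to
    primitive vectors: its reduction is a constant multiple of a morphism,
    which has no common zero. *)
Lemma good_reduction_forms : good_reduction pi phi ->
  exists c (A B : {mpoly R[2]}),
  [/\ c != 0, c *: num phi = map_mpoly val A & c *: den phi = map_mpoly val B] /\
  [/\ A \is (deg phi).-homog, B \is (deg phi).-homog &
      forall u : 'I_2 -> R, (u ord0 \is a GRing.unit) || (u ord_max \is a GRing.unit) ->
        (A.@[u] \is a GRing.unit) || (B.@[u] \is a GRing.unit)].
Proof.
case=> psi [A [B [[[c [c0 cA cB]] [m mU]] AB]] d_eq].
have hA : A \is (deg phi).-homog.
  by apply: (map_mpoly_homog_inj val_inj); rewrite -cA rpredZ ?num_homog.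
have hB : B \is (deg phi).-homog.
  by apply: (map_mpoly_homog_inj val_inj); rewrite -cB rpredZ ?den_homog.
exists c, A, B; split; first by split; [exact: c0|exact: cA|exact: cB].
split; [exact: hA|exact: hB|move=> u].
rewrite -!residue_neq0 -!meval_map_mpoly.
apply: (proportional_forms_eval (psi := psi)) AB; rewrite -?d_eq ?map_mpoly_homog//.
move: mU; rewrite -!residue_neq0 -!mcoeff_map_mpoly.
by case/orP => h; apply/orP; [left|right]; apply: contraNneq h => ->; rewrite mcoeff0.
Qed.

Definition poly_pair (u : {poly F} * {poly F}) (i : 'I_2) : {poly F} :=
  if i == ord0 then u.1 else u.2.

(** Here u' and v' are to be the coprime coordinates of the images of the
    points with coordinates u and v. The scaling factors e and e' need not be
    integral for num and den, but they become so for the reduced form (A, B),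
    since one of A(u), B(u) is a unit at the place; then [wedge_forms] applies
    in the local ring, one coordinate of u being a unit there. *)
Lemma wedge_image_val (u v u' v' : {poly F} * {poly F}) (e e' : K) :
  good_reduction pi phi ->
  coprimep u.1 u.2 -> coprimep v.1 v.2 ->
  u'.1%:F = e * (num phi).@[fun i => (poly_pair u i)%:F] ->
  u'.2%:F = e * (den phi).@[fun i => (poly_pair u i)%:F] ->
  v'.1%:F = e' * (num phi).@[fun i => (poly_pair v i)%:F] ->
  v'.2%:F = e' * (den phi).@[fun i => (poly_pair v i)%:F] ->
  exists2 z : K, z \in val_ring pi & (wedge u' v')%:F = (wedge u v)%:F * z.
Proof.
case/good_reduction_forms => c [A [B [[c0 cA cB] [hA hB AB]]]].
pose loc u i : R := local_of_poly pi (poly_pair u i).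
have evA w : (num phi).@[fun i => (poly_pair w i)%:F] = c^-1 * val A.@[loc w].
  by rewrite -meval_map_mpoly /= -cA mevalZ mulKf.
have evB w : (den phi).@[fun i => (poly_pair w i)%:F] = c^-1 * val B.@[loc w].
  by rewrite -meval_map_mpoly /= -cB mevalZ mulKf.
have loc_unit w : coprimep w.1 w.2 ->
    (loc w ord0 \is a GRing.unit) || (loc w ord_max \is a GRing.unit).
  move=> cw; have pi1 : (1 < size (place_poly pi))%N by have [] := place_irr pi.
  have [d0|n0] := boolP (place_poly pi %| w.1); last by rewrite local_of_poly_unit.
  have [d1|n1] := boolP (place_poly pi %| w.2); last first.
    by rewrite [X in _ || X]local_of_poly_unit ?orbT.
  by have /coprimepP/(_ _ d0 d1) := cw; rewrite -size_poly_eq1 => /eqP s1; rewrite s1 in pi1.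
have scale_int w (w' : {poly F} * {poly F}) x : coprimep w.1 w.2 ->
    w'.1%:F = x * (num phi).@[fun i => (poly_pair w i)%:F] ->
    w'.2%:F = x * (den phi).@[fun i => (poly_pair w i)%:F] ->
    exists y : R, w'.1%:F = val y * val A.@[loc w] /\ w'.2%:F = val y * val B.@[loc w].
  rewrite evA evB !mulrA => cw eA eB.
  have key (a : R) f : a \is a GRing.unit -> f%:F = x / c * val a ->
      val (local_of_poly pi f / a) = x / c.
    move=> aU fE; have aV : val a * val a^-1 = 1 by rewrite -rmorphM mulrV// rmorph1.
    transitivity (f%:F * val a^-1); first exact: rmorphM.
    by rewrite fE -[LHS]mulrA -[RHS]mulr1; congr (_ * _).
  by case/orP: (AB _ (loc_unit w cw)) => aU;
    [exists (local_of_poly pi w'.1 / A.@[loc w])|exists (local_of_poly pi w'.2 / B.@[loc w])];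
    rewrite key.
move=> cu cv /(scale_int _ _ _ cu) sc /sc{sc} [y [u1 u2]].
move=> /(scale_int _ _ _ cv) sc /sc{sc} [y' [v1 v2]].
have [i iU] : exists i, loc u i \is a GRing.unit.
  by case/orP: (loc_unit u cu) => iU; [exists ord0|exists ord_max].
have [t tE] := wedge_forms (loc u) (loc v) i hA hB.
pose q := loc u i ^+ deg phi; have qU : q \is a GRing.unit by rewrite unitrX.
exists (val (y * y' * (q^-1 * t))); first exact: valP.
set W := wedge (A.@[_], _) _ in tE; set D := wedge _ _ in tE.
have -> : (wedge u v)%:F = val D by rewrite /wedge rmorphB !rmorphM.
have -> : (wedge u' v')%:F = val (y * y' * W).
  by rewrite rmorph_wedge /= -u1 -u2 -v1 -v2 /wedge rmorphB !rmorphM.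
have -> : W = D * (q^-1 * t) by rewrite mulrCA -tE mulKr.
by rewrite mulrCA rmorphM.
Qed.

End GoodReductionLocal.

(** * Good reduction at all finite places *)

Section Places.
Variable F : fieldType.
Local Notation K := {fraction {poly F}}.
Implicit Types f g : {poly F}.

Lemma place_dvd f : (1 < size f)%N -> exists pi : finite_place F, place_poly pi %| f.
Proof.
have [n] := ubnP (size f); elim: n f => // n IH f; rewrite ltnS => fn f1.
have f0 : f != 0 by rewrite -size_poly_gt0 ltnW.
have [irr|red] := classic (irreducible_poly f).
  have c0 : (lead_coef f)^-1 != 0 by rewrite invr_eq0 lead_coef_eq0.
  have m : (lead_coef f)^-1 *: f \is monic by rewrite monicE lead_coefZ mulVf ?lead_coef_eq0.
  have {}irr : irreducible_poly ((lead_coef f)^-1 *: f).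
    split=> [|q q1]; first by rewrite size_scale.
    rewrite dvdpZr// => qf; have := irr.2 q q1 qf; move/eqp_trans; apply.
    by rewrite eqp_sym eqp_scale.
  by exists (FinitePlace irr m); rewrite /= dvdpZl.
have [q [q1 qf nqf]] : exists q : {poly F}, [/\ size q != 1%N, q %| f & ~~ (q %= f)].
  apply: NNPP => h; apply: red; split=> // q q1 qf.
  by apply: contraT => nqf; case: h; exists q.
have q_gt0 : (0 < size q)%N.
  by rewrite size_poly_gt0; apply: contraNneq f0 => q0; rewrite -dvd0p -q0.
have qlt : (size q < size f)%N by rewrite ltn_neqAle (dvdp_leq f0 qf) andbT (dvdp_size_eqp qf).
have [||pi piq] := IH q; first exact: leq_trans qlt fn.
  by rewrite ltn_neqAle eq_sym q1.
by exists pi; apply: dvdp_trans qf.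
Qed.

(** The quotient g / f is integral at every place, so its reduced denominator
    has no irreducible factor. *)
Lemma dvdp_places f g :
  (forall pi : finite_place F, exists2 z : K, z \in val_ring pi & g%:F = f%:F * z) ->
  f %| g.
Proof.
move=> h; have [f0|f0] := eqVneq f 0.
  (* Any place shows that g = 0; a factor of 'X provides one. *)
  have [|pi _] := @place_dvd 'X; first by rewrite size_polyX.
  have [z _] := h pi; rewrite f0 tofrac0 mul0r => /eqP.
  by rewrite tofrac_eq0 => /eqP->; rewrite dvdp0.
have [g0|g0] := eqVneq g 0; first by rewrite g0 dvdp0.
pose a := f %/ gcdp f g; pose b := g %/ gcdp f g.
have d0 : gcdp f g != 0 by rewrite gcdp_eq0 negb_and f0.
have fE : f = a * gcdp f g by rewrite divpK ?dvdp_gcdl.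
have gE : g = b * gcdp f g by rewrite divpK ?dvdp_gcdr.
have a0 : a != 0 by apply: contraNneq f0 => a0; rewrite fE a0 mul0r.
have b0 : b != 0 by apply: contraNneq g0 => b0; rewrite gE b0 mul0r.
have cab : coprimep a b by apply: coprimep_div_gcd; rewrite f0.
have [a1|a1] := leqP (size a) 1.
  have sa : size a == 1%N by rewrite eqn_leq a1 size_poly_gt0.
  rewrite fE; apply: (@dvdp_trans _ (gcdp f g)); last exact: dvdp_gcdr.
  by rewrite -[X in _ %| X]mul1r dvdp_mul2r// dvdp1.
have [pi pa] := place_dvd a1; have [z zR zE] := h pi.
have bz : b%:F = a%:F * z.
  have dF : (gcdp f g)%:F != 0 :> K by rewrite tofrac_eq0.
  by apply: (mulIf dF); rewrite -tofracM -gE zE {1}fE tofracM mulrAC.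
have z0 : z != 0 by apply: contraNneq b0 => z0; rewrite -tofrac_eq0 bz z0 mulr0.
have aF : a%:F != 0 :> K by rewrite tofrac_eq0.
have := valuationM pi aF z0; rewrite -bz !valuation_tofrac//.
move: zR; rewrite unfold_in /val_ring (negPf z0) /=.
have : (1 <= pmult pi a)%N by rewrite -pmult_dvd// expr1.
move=> pa1 vz vE; have : (1 <= pmult pi b)%N by lia.
rewrite -pmult_dvd// expr1 => pb.
have := (coprimepP _ _ cab) _ pa pb; rewrite -size_poly_eq1.
by have [+ _] := place_irr pi => + /eqP e; rewrite e.
Qed.

Lemma coords_endo (phi : endo K) (P : P1 K) : exists e : K,
  (coords (endo_map phi P)).1%:F = e * (num phi).@[fun i => (poly_pair (coords P) i)%:F] /\
  (coords (endo_map phi P)).2%:F = e * (den phi).@[fun i => (poly_pair (coords P) i)%:F].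
Proof.
have [c c0 cE] := coords_scale P.
have [c' c'0 c'E] := coords_scale (endo_map phi P).
have /eqmodP/proj_eqP[e e0 eE] :
    repr (endo_map phi P) = endo_hcoord phi (repr P) %[mod P1 K] by rewrite reprK.
have numE : (num phi).@[val (repr P) ord0] =
    c ^+ deg phi * (num phi).@[fun i => (poly_pair (coords P) i)%:F].
  exact: meval_homog_eq (num_homog phi) cE.
have denE : (den phi).@[val (repr P) ord0] =
    c ^+ deg phi * (den phi).@[fun i => (poly_pair (coords P) i)%:F].
  exact: meval_homog_eq (den_homog phi) cE.
have h0 := congr1 (fun w : 'rV[K]_2 => w ord0 ord0) eE.
have h1 := congr1 (fun w : 'rV[K]_2 => w ord0 ord_max) eE.
move: h0 h1; rewrite !mxE /= numE denE !c'E /= !mulrA => h0 h1.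
exists ((e * c')^-1 * c ^+ deg phi).
have ec0 := mulf_neq0 e0 c'0.
by split; rewrite -[RHS]mulrA; apply: (canRL (mulKf ec0)).
Qed.

End Places.

(** * Points equidistant from two given points *)

Lemma eqp_leadE (F : fieldType) (f g : {poly F}) :
  g != 0 -> f %= g -> f = (lead_coef f / lead_coef g) *: g.
Proof.
move=> g0 /eqp_eq e.
by rewrite mulrC -scalerA -e scalerA mulVf ?scale1r ?lead_coef_eq0.
Qed.

Section Equidistant.
Variable F : finFieldType.
Local Notation K := {fraction {poly F}}.

(** The ratio of the two chords is a nonzero constant, and by
    [wedge_ratio_inj] distinct points have distinct ratios. *)
Lemma card_equidistant (P Q : P1 K) (s : seq (P1 K)) :
  P != Q -> uniq s -> (forall R, R \in s -> chord P R %= chord Q R) ->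
  (size s <= #|F|.-1)%N.
Proof.
move=> PQ us hs.
pose c R := lead_coef (chord P R) / lead_coef (chord Q R).
have h0 R : R \in s -> chord Q R != 0.
  move=> Rs; apply: contraNneq PQ => QR; have := hs R Rs; rewrite QR eqp0 chord_eq0 => /eqP->.
  by move/eqP: QR; rewrite chord_eq0 eq_sym.
have cE R : R \in s -> chord P R = c R *: chord Q R.
  by move=> Rs; apply: eqp_leadE (h0 R Rs) (hs R Rs).
have c0 R : R \in s -> c R != 0.
  move=> Rs; apply: mulf_neq0; rewrite ?invr_eq0 lead_coef_eq0 -size_poly_eq0.
    by rewrite (eqp_size (hs R Rs)) size_poly_eq0; apply: h0.
  by rewrite size_poly_eq0; apply: h0.
have cinj : {in s &, injective c}.
  move=> R S Rs Ss cRS; apply/eqP; rewrite -chord_eq0.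
  apply/eqP; apply: (@wedge_ratio_inj _ (coords P) (coords Q) _ _ (c R)%:P).
  - by rewrite mul_polyC; apply: cE.
  - by rewrite cRS mul_polyC; apply: cE.
  - by rewrite [_ == _](chord_eq0 P Q).
have -> : #|F|.-1 = #|predC1 (0 : F)| by rewrite cardC1.
rewrite cardE -(size_map c); apply: uniq_leq_size; first by rewrite map_inj_in_uniq.
by move=> _ /mapP[R Rs ->]; rewrite mem_enum inE c0.
Qed.

End Equidistant.

(** * Indices avoiding two residue classes *)

Lemma card_dvdn_shift r m c :
  (0 < r)%N -> (#|[set i : 'I_(r * m) | (r %| c + i)%N]| <= m)%N.
Proof.
move=> r0; have lt (i : 'I_(r * m)) : (i %/ r < m)%N by rewrite ltn_divLR// [(m * r)%N]mulnC.
pose g (i : 'I_(r * m)) := Ordinal (lt i).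
rewrite -[X in (_ <= X)%N]card_ord -(@card_in_imset _ _ g) ?max_card//.
move=> i j; rewrite !inE => ri rj /(congr1 (fun k : 'I_m => nat_of_ord k)) /= e.
apply/val_inj => /=; rewrite (divn_eq i r) (divn_eq j r) e; congr (_ + _)%N.
by apply/eqP; rewrite -(eqn_modDl c) (eqP ri) (eqP rj).
Qed.

(** At most m indices are lost to each of the two divisibility conditions,
    which coincide when r divides m. *)
Lemma card_avoid_dvdn r m : (0 < r)%N ->
  (r * m <= #|[set i : 'I_(r * m) | ~~ (r %| i)%N && ~~ (r %| m + i)%N]| +
            (1 + ~~ (r %| m)) * m)%N.
Proof.
move=> r0; set A := [set i | _].
rewrite -[X in (X <= _)%N]card_ord -(cardsC A) leq_add2l.
have -> : ~: A = [set i : 'I_(r * m) | (r %| 0 + i)%N]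
             :|: [set i : 'I_(r * m) | (r %| m + i)%N].
  by apply/setP => i; rewrite !inE negb_and !negbK add0n.
have [rm|_] := boolP (r %| m)%N; last first.
  by apply: leq_trans (leq_card_setU _ _) _; rewrite mul2n -addnn leq_add ?card_dvdn_shift.
rewrite mul1n; apply: leq_trans (card_dvdn_shift m 0 r0).
by apply/subset_leq_card/subsetP => i; rewrite !inE add0n (dvdn_addr _ rm) => /orP[].
Qed.

(** * Cycles of nonexpanding maps *)

Section Nonexpanding.
Variable F : fieldType.
Local Notation K := {fraction {poly F}}.

(** In terms of distances at the finite places: f does not move any two points
    apart. *)
Definition nonexpanding (f : P1 K -> P1 K) : Prop :=
  forall P Q, chord P Q %| chord (f P) (f Q).

Lemma good_reduction_nonexpanding (phi : endo K) :
  (forall pi : finite_place F, good_reduction pi phi) -> nonexpanding (endo_map phi).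
Proof.
move=> good P Q; apply: dvdp_places => pi.
have [e [e1 e2]] := coords_endo phi P; have [e' [e1' e2']] := coords_endo phi Q.
exact: wedge_image_val (good pi) (coords_coprime P) (coords_coprime Q) e1 e2 e1' e2'.
Qed.

Lemma nonexpanding_iter f k : nonexpanding f -> nonexpanding (iter k f).
Proof.
move=> hf P Q; elim: k => [|k IH]; first exact: dvdpp.
exact: dvdp_trans IH (hf _ _).
Qed.

(** The chord from P to f^(k i) P is bounded by k steps of length i, each of
    which is a translate of the first. *)
Lemma chord_iterM f k i P : nonexpanding f ->
  chord P (iter i f P) %| chord P (iter (k * i) f P).
Proof.
move=> hf; elim: k => [|k IH].
  by rewrite mul0n; have /eqP-> : chord P P == 0; rewrite ?chord_eq0 ?dvdp0.
apply: dvdp_chord_trans IH _; rewrite mulSnr iterD.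
exact: nonexpanding_iter.
Qed.

Section Cycle.
Variables (f : P1 K -> P1 K) (P : P1 K) (n : nat).
Hypotheses (hf : nonexpanding f) (n_gt0 : (0 < n)%N) (fnP : iter n f P = P).

Lemma iter_modn i : iter (i %% n) f P = iter i f P.
Proof.
rewrite [in RHS](divn_eq i n) addnC iterD; congr (iter _ _ _).
by elim: (i %/ n)%N => //= k IH; rewrite mulSn iterD -IH.
Qed.

(** Divisibility goes forward along the cycle and comes back to its start
    after n steps. *)
Lemma chord_translate m i : chord P (iter i f P) %= chord (iter m f P) (iter (m + i) f P).
Proof.
have up k : chord P (iter i f P) %| chord (iter k f P) (iter (k + i) f P).
  by rewrite iterD; apply: nonexpanding_iter.
apply/andP; split; first exact: up.
have -> : chord P (iter i f P) = chord (iter (m * n) f P) (iter (m * n + i) f P).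
  by rewrite -(iter_modn (m * n)) -(iter_modn (m * n + i)) modnMl modnMDl iter_modn.
have := nonexpanding_iter (m * n - m) hf (iter m f P) (iter (m + i) f P).
by rewrite -!iterD addnA subnK// leq_pmulr.
Qed.

(** Modulo n, each of i and j is a multiple of the other, so [chord_iterM]
    gives divisibility both ways. *)
Lemma chord_gcdn i j : gcdn i n = gcdn j n -> chord P (iter i f P) %= chord P (iter j f P).
Proof.
suff dv a b : gcdn a n = gcdn b n -> chord P (iter a f P) %| chord P (iter b f P).
  by move=> e; apply/andP; split; apply: dv.
move=> e; have [a0|a0] := posnP a.
  have /dvdnP[k ->] : (n %| b)%N by rewrite a0 gcd0n in e; rewrite e dvdn_gcdl.
  by rewrite a0 -(iter_modn (k * n)) modnMl dvdpp.
have [k [l kl]] : exists k l, (k * a = b + l * n)%N.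
  have [ka kn kan _] := egcdnP n a0.
  have /dvdnP[t tE] : (gcdn a n %| b)%N by rewrite e dvdn_gcdl.
  by exists (t * ka)%N, (t * kn)%N; rewrite -mulnA kan tE mulnDr mulnA addnC.
have -> : iter b f P = iter (k * a) f P.
  by rewrite kl addnC -(iter_modn (_ + b)) modnMDl iter_modn.
exact: chord_iterM.
Qed.

Hypothesis n_min : forall m, (0 < m < n)%N -> iter m f P <> P.

Lemma iter_inj_period i j :
  (i < n)%N -> (j < n)%N -> iter i f P = iter j f P -> i = j.
Proof.
wlog ij : i j / (i <= j)%N.
  by move=> h; case/orP: (leq_total i j) => ij ? ? ?; [|apply/esym]; apply: h.
move=> _ jn /(congr1 (iter (n - j) f)); rewrite -!iterD subnK 1?ltnW// fnP => e.
apply/eqP; rewrite eqn_leq ij /= leqNgt; apply/negP => ij'.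
by apply: (n_min _ e); lia.
Qed.

End Cycle.
End Nonexpanding.

Section Counting.
Variable F : finFieldType.
Local Notation K := {fraction {poly F}}.

Section CycleLength.
Variables (f : P1 K -> P1 K) (P : P1 K) (n : nat).
Hypotheses (hf : nonexpanding f) (n_gt0 : (0 < n)%N) (fnP : iter n f P = P).
Hypothesis n_min : forall m, (0 < m < n)%N -> iter m f P <> P.

(** For these indices i, both i and m + i are prime to r, so their gcds with
    n = r m are those with m, and agree: the point f^(m + i) P is equidistant
    from P and f^m P. *)
Lemma card_coprime_pairs r m : prime r -> n = (r * m)%N ->
  (#|[set i : 'I_n | ~~ (r %| i)%N && ~~ (r %| m + i)%N]| <= #|F|.-1)%N.
Proof.
move=> pr nE; set A := [set i : 'I_n | _].
have r1 := prime_gt1 pr.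
have m0 : (0 < m)%N by move: n_gt0; rewrite nE muln_gt0 => /andP[].
pose s := [seq iter (m + (i : 'I_n)) f P | i in A].
have <- : size s = #|A| by rewrite size_map cardE.
apply: (@card_equidistant _ P (iter m f P)).
- apply/eqP => /esym; apply: n_min; rewrite m0 nE; apply: ltn_Pmull => //.
- rewrite map_inj_in_uniq ?enum_uniq// => i j _ _ e.
  apply/val_inj; apply: (iter_inj_period n_gt0 fnP n_min) => //=.
  have {e} := congr1 (iter (n - m) f) e; rewrite -!iterD.
  have mn : (m <= n)%N by rewrite nE leq_pmull// ltnW.
  by rewrite !addnA subnK// ![(n + _)%N]addnC !iterD fnP.
move=> R /mapP[i]; rewrite mem_enum inE => /andP[ri rmi] ->.
have gE j : ~~ (r %| j)%N -> gcdn j n = gcdn j m.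
  by move=> rj; rewrite nE Gauss_gcdr// coprime_sym prime_coprime.
apply: eqp_trans (chord_translate hf n_gt0 fnP m i); apply: (chord_gcdn hf fnP).
by rewrite (gE _ rmi) (gE _ ri) gcdnC gcdnDl gcdnC.
Qed.

(** Unless n <= 2, either 4 divides n, and r = 2 loses only half of the
    indices, or n has an odd prime factor r, which keeps a proportion
    1 - 2 / r >= 1 / 3 of them. *)
Lemma period_bound : (n <= maxn 2 (3 * #|F|.-1))%N.
Proof.
have [n2|n2] := leqP n 2; first by rewrite leq_max n2.
rewrite leq_max; apply/orP; right.
have [/dvdnP[l nE]|n4] := boolP (4 %| n)%N.
  have n2E : n = (2 * (2 * l))%N by lia.
  have := card_coprime_pairs (isT : prime 2) n2E; rewrite n2E.
  have := card_avoid_dvdn (2 * l) (isT : 0 < 2)%N; rewrite dvdn_mulr// mul1n; lia.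
have [h h_odd [h_gt1 h_dvd]] : exists2 h, odd h & (1 < h)%N /\ (h %| n)%N.
  have [no|ne] := boolP (odd n); first by exists n; last by split; [lia|].
  have n_half : n = (2 * n./2)%N by lia.
  exists n./2; last by split; [lia|rewrite {2}n_half dvdn_mull].
  by apply: contraNT n4 => h_even; apply/dvdnP; exists (n./2)./2; lia.
have pr := pdiv_prime h_gt1.
have r_odd : odd (pdiv h) by apply: dvdn_odd (pdiv_dvd h) h_odd.
have r_gt2 : (2 < pdiv h)%N by have := prime_gt1 pr; lia.
have /dvdnP[m nE] : (pdiv h %| n)%N := dvdn_trans (pdiv_dvd h) h_dvd.
move: (pdiv h) pr r_odd r_gt2 nE => r pr _ r_gt2; rewrite mulnC => nE.
have := card_coprime_pairs pr nE; rewrite nE.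
have := card_avoid_dvdn m (ltnW (ltnW r_gt2)).
have : (1 + ~~ (r %| m) <= 2)%N by case: (_ %| _)%N.
move: (1 + _)%N #|_| => c k c2 ck kq; move: ck r_gt2 kq c2; clear; nia.
Qed.

End CycleLength.

(** * Preperiodic orbits *)

(** Let k be the first time at which the orbit reaches Z, and Q its point at
    time k - 1. For R at an earlier time, chord R Q divides chord R Z because
    Z is reached from R by steps of the length of the one from R to Q; and
    chord R Z divides chord Q Z because Z is fixed. So R is equidistant from Z
    and Q, and there are k - 1 such points. *)
Lemma iter_card_fixed (f : P1 K -> P1 K) P Z k : nonexpanding f ->
  f Z = Z -> iter k f P = Z -> iter #|F| f P = Z.
Proof.
move=> hf fZ kZ; have exk : exists k, iter k f P == Z by exists k; apply/eqP.
case: (ex_minnP exk) => {kZ exk}k /eqP kZ k_min.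
suff /subnK <- : (k <= #|F|)%N by rewrite iterD kZ iter_fix.
have F0 : (0 < #|F|)%N by rewrite (cardD1 0).
case: k kZ k_min => // k kZ k_min; rewrite -(ltn_predK F0) ltnS.
have Q_neq : Z != iter k f P.
  by apply/eqP => e; have := k_min k; rewrite -e eqxx ltnn => /(_ isT).
rewrite -(size_iota 0 k) -(size_map (fun i => iter i f P)).
apply: card_equidistant Q_neq _ _.
  rewrite map_inj_in_uniq ?iota_uniq// => i j; rewrite !mem_iota !add0n /=.
  wlog ij : i j / (i < j)%N.
    move=> h ik jk e; case: (ltngtP i j) => // ij; first exact: h.
    by apply/esym/h.
  move=> ik jk e; have := k_min (k.+1 - j + i)%N.
  by rewrite iterD e -iterD subnK ?kZ ?eqxx => [/(_ isT)|]; lia.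
move=> R /mapP[i]; rewrite mem_iota add0n /= => ik ->.
have [d d0 kE] : exists2 d, (0 < d)%N & k = (d + i)%N by exists (k - i)%N; lia.
have QE : iter k f P = iter d f (iter i f P) by rewrite kE iterD.
(* Z being fixed, any multiple of d not less than k.+1 - i will do. *)
have ZE : Z = iter (k.+1 * d) f (iter i f P).
  rewrite -iterD -[LHS](iter_fix (k.+1 * d + i - k.+1) fZ) -{1}kZ -iterD.
  by congr iter; nia.
rewrite QE; move: (iter i f P) ZE => {QE}R ZE.
rewrite eqp_chordC; apply/andP; split; last by rewrite ZE; apply: chord_iterM.
apply: dvdp_chord_trans (dvdpp _) _; rewrite dvdp_chordC.
by have := nonexpanding_iter d hf R Z; rewrite (iter_fix _ fZ).
Qed.

(** Some point of the psi-orbit lies on the cycle, hence is fixed by psi = f^n;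
    then f^(q n) P is such a point too, and the orbit of P repeats itself after
    q n + n steps. *)
Lemma card_orbit (f : P1 K -> P1 K) P : nonexpanding f -> preperiodic f P ->
  card_le (forward_orbit f P) ((#|F| + 1) * maxn 2 (3 * #|F|.-1)).
Proof.
move=> hf [_ [m ->] [n0 n0_gt0 /eqP n0P]].
pose per n := (0 < n)%N && (iter n f (iter m f P) == iter m f P).
have ex_per : exists n, per n by exists n0; rewrite /per n0_gt0.
case: (ex_minnP ex_per) => n /andP[n_gt0 /eqP nP] n_min.
have n_le : (n <= maxn 2 (3 * #|F|.-1))%N.
  apply: (period_bound hf n_gt0 nP) => i /andP[i0 ilt] iP.
  by have := n_min i; rewrite /per i0 iP eqxx leqNgt ilt => /(_ isT).
(* P enters its cycle after m steps, and m <= m * n. *)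
have fix_n : iter n f (iter (m * n) f P) = iter (m * n) f P.
  have /subnK <- : (m <= m * n)%N by rewrite leq_pmulr.
  by rewrite iterD -iterD addnC iterD nP.
have itM k : iter k (iter n f) P = iter (k * n) f P.
  by elim: k => //= k ->; rewrite mulSn iterD.
have := iter_card_fixed (nonexpanding_iter n hf) fix_n (itM m); rewrite itM => qE.
have N_loop : iter ((#|F| + 1) * n) f P = iter (#|F| * n) f P.
  by rewrite mulnDl mul1n addnC iterD qE fix_n.
pose s := [seq iter i f P | i <- iota 0 ((#|F| + 1) * n)].
exists [fset x in s]%fset; last first.
  rewrite card_fseq (leq_trans (size_undup _))// size_map size_iota.
  by rewrite leq_mul2l n_le orbT.
move=> x; rewrite in_fset; split=> [[i ->]|/mapP[i _ ->]]; last by exists i.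
elim/ltn_ind: i => i IH; have [lt|ge] := ltnP i ((#|F| + 1) * n).
  by apply/mapP; exists i; rewrite ?mem_iota.
have -> : iter i f P = iter (i - n) f P.
  have -> : i = (i - (#|F| + 1) * n + (#|F| + 1) * n)%N by rewrite subnK.
  rewrite iterD N_loop -iterD; congr iter; rewrite mulnDl; lia.
by apply: IH; nia.
Qed.

End Counting.

Theorem theorem1p2 (p : nat) (p_prime : prime p)
    (phi : endo {fraction {poly 'F_p}})
    (deg_phi : (2 <= deg phi)%N)
    (phi_good : forall pi : finite_place 'F_p, good_reduction pi phi)
    (P : P1 {fraction {poly 'F_p}}) :
  (forall n : nat, minimal_period (endo_map phi) P n ->
    [/\ p = 2%N -> (n <= 3)%N,
        p = 3%N -> (n <= 72)%N
      & (5 <= p)%N -> (n <= (p ^ 2 - 1) * p)%N]) /\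
  (preperiodic (endo_map phi) P ->
    [/\ p = 2%N -> card_le (forward_orbit (endo_map phi) P) 9,
        p = 3%N -> card_le (forward_orbit (endo_map phi) P) 288
      & (5 <= p)%N ->
        card_le (forward_orbit (endo_map phi) P) ((p + 1) * (p ^ 2 - 1) * p)]).
Proof.
have h := good_reduction_nonexpanding phi_good.
have card_weaken (A : P1 {fraction {poly 'F_p}} -> Prop) M N :
    (M <= N)%N -> card_le A M -> card_le A N.
  by move=> MN [S SA SM]; exists S => //; apply: leq_trans MN.
have large : (5 <= p)%N -> (maxn 2 (3 * p.-1) <= (p ^ 2 - 1) * p)%N.
  by move=> p5; nia.
split=> [n [n0 nP nmin]|pre].
  have := period_bound h n0 nP nmin; rewrite (card_Fp p_prime) => nb.
  by split=> p_eq; apply: leq_trans nb _; rewrite ?p_eq// large.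
have := card_orbit h pre; rewrite (card_Fp p_prime) => orb.
split=> p_eq; apply: card_weaken orb; rewrite ?p_eq//.
by rewrite -mulnA leq_mul2l large ?orbT.
Qed.
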